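(* Let $q\ge1$ be an integer, let $x$ be a real number, and let $\beta$ be a real number such that none of the numbers $\frac hq+\beta$, $h=0,1,\dots,q-1$, is a nonpositive integer. Then $$\left.\frac{\partial E_{\alpha,\beta}(x)}{\partial\beta}\right|_{\alpha=1/q}=-\sum_{h=0}^{q-1}\frac{x^h}{\Gamma\left(\frac hq+\beta\right)}\left[\psi\left(\frac hq+\beta\right)+Q\left(\frac hq+\beta,\;x^q\right)\right].$$
   Context: The two-parameter Mittag-Leffler function is $E_{\alpha,\beta}(x)=\sum_{k=0}^\infty\frac{x^k}{\Gamma(\alpha k+\beta)}$ (with $1/\Gamma=0$ at the poles of $\Gamma$, and $x^0=1$). The digamma function is $\psi=\Gamma'/\Gamma$ and $(a)_k=a(a+1)\cdots(a+k-1)$ is the Pochhammer symbol. For $a\notin\{0,-1,-2,\dots\}$ the function $Q$ is $$Q(a,x):=\sum_{k=1}^\infty\frac{x^k}{(a)_k}\psi(k+a)=e^x\left[x^{1-a}\psi(a)\gamma(a,x)+\frac{x}{a^2}\,{}_2F_2\left(a,a;a+1,a+1;-x\right)\right],$$ where $\gamma(a,x)=\int_0^x e^{-t}t^{a-1}dt$ is the lower incomplete gamma function (analytically continued in $a$; $x^{-a}\gamma(a,x)=\sum_{j\ge0}\frac{(-x)^j}{j!(a+j)}$ is entire in $x$) and ${}_2F_2$ is the generalized hypergeometric function. *)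

(* Defs.v *)
From HB Require Import structures.
From mathcomp Require Import all_boot all_order all_algebra.
From mathcomp Require Import all_classical all_reals all_analysis.

Set Implicit Arguments.
Unset Strict Implicit.
Unset Printing Implicit Defensive.

Import Order.TTheory GRing.Theory Num.Theory.
Import numFieldNormedType.Exports.

Local Open Scope classical_set_scope.
Local Open Scope ring_scope.

Definition pochhammer (R : realType) (a : R) (k : nat) : R :=
  \prod_(i < k) (a + i%:R).

Definition euler_Gamma (R : realType) (x : R) : R :=
  \int[@lebesgue_measure R]_(t in `]0, +oo[) (t `^ (x - 1) * expR (- t)).

(* For x <= 0 the integral is continued by Gamma(x) = Gamma(x + n) / (x)_n,
   where n is the least natural number such that 0 < x + n.  At the poles
   x = 0, -1, -2, ... one has (x)_n = 0, so Gamma takes the value 0 there and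
   (Gamma x)^-1 = 0, the usual convention for the reciprocal Gamma function
   (see invr_Gamma_pole). *)
Definition Gamma (R : realType) (x : R) : R :=
  if 0 < x then euler_Gamma x
  else let n := (Num.truncn (- x)).+1 in
       euler_Gamma (x + n%:R) / pochhammer x n.

Lemma invr_Gamma_pole (R : realType) (m : nat) : (Gamma (- m%:R : R))^-1 = 0.
Proof.
rewrite /Gamma oppr_gt0 ltrn0 opprK natrK /pochhammer big_ord_recr /= addNr.
by rewrite mulr0 invr0 mulr0 invr0.
Qed.

Definition digamma (R : realType) (x : R) : R := derive1 (@Gamma R) x / Gamma x.

Definition mittag_leffler (R : realType) (alpha beta x : R) : R :=
  limn (series (fun k : nat => x ^+ k / Gamma (alpha * k%:R + beta))).

(* Here k stands for the k + 1 of the series sum_(k >= 1). *)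
Definition Qfun (R : realType) (a x : R) : R :=
  limn (series (fun k : nat =>
    x ^+ k.+1 / pochhammer a k.+1 * digamma (k.+1%:R + a))).

(* Main.v *)
Require Import Defs.
From HB Require Import structures.
From mathcomp Require Import all_boot all_order all_algebra.
From mathcomp Require Import all_classical all_reals all_analysis.
From mathcomp Require Import measurable_realfun.
From mathcomp Require Import ring lra.

Set Implicit Arguments.
Unset Strict Implicit.
Unset Printing Implicit Defensive.

Import Order.TTheory GRing.Theory Num.Theory.
Import numFieldNormedType.Exports.

Local Open Scope classical_set_scope.
Local Open Scope ring_scope.

(** The proof reduces differentiation of the Mittag-Leffler series in beta to
    differentiation of a series whose terms are elementary.  Put y = x ^+ q and
    split the index as k = n * q + h with h < q.  Since k / q + b = a + n with
    a = h / q + b, and Gamma (a + n) = (a)_n Gamma a, the terms with a given h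
    add up to

      x ^+ h / Gamma a * \sum_n y ^+ n / (a)_n .

    Call the last sum [confluent a y]; it is the confluent hypergeometric
    function 1F1 (1; a; y).  Its terms are reciprocals of polynomials in a, with
    derivative - y ^+ n / (a)_n * \sum_(j < n) (a + j)^-1, and both series are
    dominated by an exponential series uniformly for a in a neighbourhood of any
    point that is not a nonpositive integer.  Hence [confluent] may be
    differentiated term by term.  The recurrence
    digamma (a + n) = digamma a + \sum_(j < n) (a + j)^-1 recognises the outcome:

      digamma a * confluent a y - d/da (confluent a y)
        = \sum_n y ^+ n / (a)_n * digamma (a + n) = digamma a + Qfun a y,

    the n = 0 term being digamma a, so that confluent a y / Gamma a has derivative
    - (digamma a + Qfun a y) / Gamma a, and summing over h gives the formula.

    What is used of Gamma is that, off its poles, it satisfies Gamma (a + 1) = a Gamma a, does not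
    vanish and is differentiable.  These facts are derived from the Euler
    integral, the last one by differentiating under the integral sign, and then
    carried over to negative arguments with the functional equation. *)

(** * The Euler integrand on the half line *)

Section GammaIntegrand.
Context {R : realType}.
Implicit Types s t : R.
Local Notation mu := (@lebesgue_measure R).
Local Notation Rpos := (`]0%R, +oo[%classic : set R).

Definition gamma_integrand s t : R := t `^ (s - 1) * expR (- t).

Lemma gamma_integrand_ge0 s t : 0 <= gamma_integrand s t.
Proof. by rewrite mulr_ge0 ?powR_ge0 ?expR_ge0. Qed.

Lemma measurable_gamma_integrand s (A : set R) :
  measurable_fun A (gamma_integrand s).
Proof.
apply: (measurable_funS measurableT) => //.
apply: measurable_funM; first exact: measurable_powR.
by apply: measurableT_comp => //; exact: measurable_expR.
Qed.

(** Compact intervals filling the open half line: the fundamental theorem of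
    calculus needs an interval avoiding 0, where the Euler integrand and its
    primitives may be singular. *)
Definition exhaust (n : nat) : set R := `[n.+2%:R^-1, n.+2%:R].

Lemma exhaust_gt0 n t : exhaust n t -> 0 < t.
Proof.
by rewrite /exhaust/= in_itv/= => /andP[+ _]; apply: lt_le_trans; rewrite invr_gt0.
Qed.

Lemma cvg_integral_exhaust (f : R -> R) : measurable_fun Rpos f ->
  (forall t, 0 <= f t) ->
  (\int[mu]_(t in exhaust n) (f t)%:E)%E @[n --> \oo] -->
  (\int[mu]_(t in Rpos) (f t)%:E)%E.
Proof.
move=> mf f0.
have -> : Rpos = \bigcup_n exhaust n.
  apply/seteqP; split => t /=; last first.
    by move=> [n _ /exhaust_gt0 t0]; rewrite in_itv/= andbT.
  rewrite in_itv/= andbT => t0.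
  have [n ht] : exists n : nat, t + t^-1 <= n%:R.
    exists (Num.truncn (t + t^-1)).+1; exact/ltW/truncnS_gt.
  exists n => //; rewrite /exhaust /= in_itv/=.
  have hn : n%:R <= n.+2%:R :> R by rewrite ler_nat leqW.
  have it0 : 0 < t^-1 by rewrite invr_gt0.
  rewrite -[leRHS]invrK lef_pV2 ?posrE// ?invr_gt0//.
  by apply/andP; split; lra.
apply: ge0_nondecreasing_set_cvg_integral => [m n mn|n|n|n t _].
- rewrite subsetEset /exhaust; apply: subset_itv; rewrite bnd_simp ?ler_nat//.
  by rewrite lef_pV2 ?posrE ?ltr0n// ler_nat.
- exact: measurable_itv.
- apply/measurable_EFinP; apply: measurable_funS mf => //.
  by move=> t /exhaust_gt0; rewrite /= in_itv/= andbT.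
- by rewrite lee_fin f0.
Qed.

Lemma integral_exhaust_FTC (F f : R -> R) n :
  (forall t, 0 < t -> is_derive t 1 F (f t)) ->
  (forall t, 0 < t -> derivable f t 1) ->
  (\int[mu]_(t in exhaust n) (f t)%:E)%E =
  (F n.+2%:R - F n.+2%:R^-1)%:E.
Proof.
move=> dF df.
have a0 : (0 : R) < n.+2%:R^-1 by rewrite invr_gt0.
have b0 : (0 : R) < n.+2%:R by [].
have ab : (n.+2%:R^-1 : R) < n.+2%:R.
  by rewrite (@lt_trans _ _ 1)// ?ltr1n// invf_lt1// ltr1n.
have cF t : 0 < t -> {for t, continuous F}.
  by move=> t0; apply/differentiable_continuous/derivable1_diffP; case: (dF t t0).
rewrite EFinB; apply: continuous_FTC2 => //.
- apply: derivable_within_continuous => t; rewrite in_itv/= => /andP[at_ _].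
  exact/df/(lt_le_trans a0).
- split.
  + move=> t; rewrite in_itv/= => /andP[at_ _].
    by case: (dF t (lt_trans a0 at_)).
  + exact/cvg_at_right_filter/cF.
  + exact/cvg_at_left_filter/cF.
- move=> t; rewrite in_itv/= => /andP[at_ _].
  by rewrite derive1E; case: (dF t (lt_trans a0 at_)).
Qed.

(** Comes from u <= exp u at u = t / p, raised to the power p. *)
Lemma powR_le_expR (p t : R) : 0 < p -> 0 < t -> t `^ p <= p `^ p * expR t.
Proof.
move=> p0 t0.
have -> : t = p * (t / p) by rewrite mulrC divfK// gt_eqF.
have u0 : 0 < t / p by rewrite divr_gt0.
rewrite powRM ?(ltW p0) ?(ltW u0)// ler_pM2l ?powR_gt0//.
rewrite [p * _]mulrC expRM; apply: ge0_ler_powR; rewrite ?nnegrE ?expR_ge0 ?ltW//.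
by rewrite (lt_le_trans _ (expR_ge1Dx _))// ltrDr.
Qed.

End GammaIntegrand.

(** * The Euler integral *)

Section GammaHalfLine.
Context {R : realType}.
Implicit Types s t : R.
Local Notation mu := (@lebesgue_measure R).
Local Notation Rpos := (`]0%R, +oo[%classic : set R).

(** Up to a constant factor, the right-hand side is the derivative of the bounded
    function - (1 + t `^ s)^-1.  This one majorant controls the integrand both at
    0 and at infinity; it holds since (1 + t `^ s)^2 is O(exp t) on the half
    line. *)
Lemma gamma_integrand_le s t : 0 < s -> 0 < t ->
  gamma_integrand s t <=
  2 * (1 + (2 * s) `^ (2 * s)) * (t `^ (s - 1) * (1 + t `^ s) ^- 2).
Proof.
move=> s0 t0; rewrite mulrCA /gamma_integrand ler_pM2l ?powR_gt0//.
have s20 : 0 < 2 * s by rewrite mulr_gt0.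
have w0 : 0 < 1 + t `^ s by rewrite ltr_pwDl// powR_ge0.
rewrite expRN ler_pdivlMr ?exprn_gt0// mulrC ler_pdivrMr ?expR_gt0//.
have h := powR_le_expR s20 t0.
have e1 : 1 <= expR t by have := expR_ge1Dx t; lra.
have tt : t `^ (2 * s) = (t `^ s) ^+ 2.
  by rewrite mulrC powRrM powR_mulrn// powR_ge0.
rewrite tt in h.
have := sqr_ge0 (1 - t `^ s).
rewrite sqrrB sqrrD expr1n mul1r; nra.
Qed.

(** The primitive of the majorant takes values in [-1, 0], so all its integrals
    over the exhausting intervals are at most 1. *)
Lemma integrable_gamma_integrand s : 0 < s ->
  mu.-integrable Rpos (EFin \o gamma_integrand s).
Proof.
move=> s0.
pose F t := - (1 + t `^ s)^-1.
pose f t := (1 + t `^ s) ^- 2 * (s * t `^ (s - 1)).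
have w0 t : 0 < 1 + t `^ s by rewrite ltr_pwDl// powR_ge0.
have f0 t : 0 <= f t.
  by rewrite mulr_ge0 ?mulr_ge0 ?powR_ge0 ?invr_ge0 ?exprn_ge0 ?ltW.
have dw t : 0 < t -> is_derive t 1 (fun t => 1 + t `^ s) (s * t `^ (s - 1)).
  move=> t0; have h := is_derive1_powR s t0.
  have := is_deriveD (is_derive_cst (1 : R) t 1) h.
  by rewrite add0r.
have dF t : 0 < t -> is_derive t 1 F (f t).
  move=> t0; have h := @is_deriveV _ (fun t => 1 + t `^ s) _ _ _ (lt0r_neq0 (w0 t)) (dw t t0).
  by have := is_deriveN h; rewrite scaleNr opprK.
have df t : 0 < t -> derivable f t 1.
  move=> t0; have dwt : derivable (fun t => 1 + t `^ s) t 1 by case: (dw t t0).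
  apply: derivableM.
    apply: (@derivableV _ _ (fun t => (1 + t `^ s) ^+ 2)).
      by rewrite expf_neq0 ?gt_eqF.
    exact: (derivableM dwt dwt).
  apply: derivableM; first exact: derivable_cst.
  by case: (is_derive1_powR (s - 1) t0).
have mf : measurable_fun Rpos f.
  apply: open_continuous_measurable_fun; first exact: interval_open.
  move=> t; rewrite inE/= in_itv/= andbT => t0.
  by apply/differentiable_continuous/derivable1_diffP/df.
have cvf := cvg_integral_exhaust mf f0.
have intf : mu.-integrable Rpos (EFin \o f).
  apply/integrableP; split; first exact/measurable_EFinP.
  under eq_integral do rewrite /= ger0_norm//.
  apply: (@le_lt_trans _ _ 1%:E); last exact: ltry.
  rewrite -(cvg_lim _ cvf)//; apply: lime_le.
    by apply/cvg_ex; eexists; exact: cvf.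
  apply: nearW => n; rewrite (integral_exhaust_FTC _ dF df) lee_fin /F.
  have i1 : (1 + n.+2%:R^-1 `^ s)^-1 <= 1 by rewrite invf_le1// lerDl powR_ge0.
  have i2 : 0 <= (1 + n.+2%:R `^ s)^-1 by rewrite invr_ge0 ltW.
  lra.
pose C := 2 * (1 + (2 * s) `^ (2 * s)) / s.
apply: (le_integrable _ _ _ (integrableZl _ C intf)) => //.
- by apply/measurable_EFinP; exact: measurable_gamma_integrand.
- move=> t /=; rewrite in_itv/= andbT => t0.
  rewrite lee_fin ger0_norm ?gamma_integrand_ge0//.
  apply/(le_trans _ (ler_norm _))/(le_trans (gamma_integrand_le s0 t0)).
  rewrite le_eqVlt; apply/orP; left; apply/eqP; rewrite /C /f.
  by field; rewrite !gt_eqF.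
Qed.

Lemma euler_GammaE s : 0 < s ->
  (\int[mu]_(t in Rpos) (gamma_integrand s t)%:E)%E = (euler_Gamma s)%:E.
Proof.
move=> s0; rewrite /euler_Gamma /Rintegral fineK//.
by apply: integrable_fin_num => //; exact: integrable_gamma_integrand.
Qed.

(** On [1, 2] the integrand is at least exp (-2) / 2, because s - 1 > -1. *)
Lemma euler_Gamma_gt0 s : 0 < s -> 0 < euler_Gamma s.
Proof.
move=> s0; rewrite -lte_fin -euler_GammaE//.
pose K := (`[1%R, 2%R]%classic : set R).
have KR : K `<=` Rpos.
  by move=> t; rewrite /K/= !in_itv/= andbT => /andP[t1 _]; rewrite (lt_le_trans _ t1).
apply: (@lt_le_trans _ _ (\int[mu]_(t in K) (cst (expR (- 2) / 2)%:E) t)%E).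
  rewrite integral_cst /K; last exact: measurable_itv.
  rewrite [X in (_ * X)%E](_ : _ = lebesgue_measure (`[1, 2]%classic : set R))//.
  rewrite lebesgue_measure_itv/= lte_fin ltr1n/=.
  by rewrite -EFinB -EFinM lte_fin mulr_gt0 ?mulr_gt0 ?expR_gt0//; lra.
apply: (@le_trans _ _ (\int[mu]_(t in K) (gamma_integrand s t)%:E)%E).
  apply: ge0_le_integral => //; first exact: measurable_itv.
  - by move=> t _; rewrite lee_fin divr_ge0// expR_ge0.
  - by apply/measurable_EFinP; exact: measurable_gamma_integrand.
  - move=> t; rewrite /K/= in_itv/= => /andP[t1 t2].
    rewrite lee_fin /gamma_integrand [leRHS]mulrC ler_pM ?expR_ge0 ?ler_expR ?lerN2//.
    rewrite -[leLHS]powR_inv1//.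
    apply: (@le_trans _ _ (t `^ (-1))).
      by rewrite !powR_inv1 ?lef_pV2 ?posrE//; lra.
    by apply: ler_powR => //; lra.
apply: ge0_subset_integral => //; try exact: measurable_itv.
- by apply/measurable_EFinP; exact: measurable_gamma_integrand.
- by move=> t _; rewrite lee_fin gamma_integrand_ge0.
Qed.

(** Integration by parts: t `^ s * exp (- t) is a primitive of the difference
    of the two integrands and tends to 0 at both ends of the exhausting
    intervals. *)
Lemma euler_GammaS s : 0 < s -> euler_Gamma (s + 1) = s * euler_Gamma s.
Proof.
move=> s0.
have s10 : 0 < s + 1 by rewrite addr_gt0.
pose F t := t `^ s * expR (- t).
pose f t := s * gamma_integrand s t - gamma_integrand (s + 1) t.
have dE t : is_derive t 1 (fun t => expR (- t)) (- expR (- t)).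
  have h : is_derive t 1 (fun t : R => - t) (- 1) by exact: is_deriveN.
  have := is_derive1_comp (is_derive_expR (- t)) h.
  by rewrite mulrN1.
have dF t : 0 < t -> is_derive t 1 F (f t).
  move=> t0; have h := is_deriveM (is_derive1_powR s t0) (dE t).
  apply: (is_derive_eq h); rewrite /f /gamma_integrand !/GRing.scale/= addrK; ring.
have dg u t : 0 < t -> derivable (gamma_integrand u) t 1.
  move=> t0; apply: derivableM; last by case: (dE t).
  by case: (is_derive1_powR (u - 1) t0).
have intK u n : 0 < u -> mu.-integrable (exhaust n) (EFin \o gamma_integrand u).
  move=> u0; apply: integrableS (integrable_gamma_integrand u0) => //.
    exact: measurable_itv.
  by move=> t /exhaust_gt0; rewrite /= in_itv/= andbT.
have cvgK u : 0 < u -> \int[mu]_(t in exhaust n) gamma_integrand u t @[n --> \oo]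
    --> euler_Gamma u.
  move=> u0; apply: fine_cvg; rewrite -euler_GammaE//.
  apply: cvg_integral_exhaust (gamma_integrand_ge0 u).
  exact: measurable_gamma_integrand.
have key n : s * \int[mu]_(t in exhaust n) gamma_integrand s t -
    (F n.+2%:R - F n.+2%:R^-1) = \int[mu]_(t in exhaust n) gamma_integrand (s + 1) t.
  have mK : measurable (exhaust n : set R) by exact: measurable_itv.
  have -> : F n.+2%:R - F n.+2%:R^-1 = \int[mu]_(t in exhaust n) f t.
    rewrite /Rintegral (integral_exhaust_FTC _ dF)// => t t0.
    by apply: derivableB; [apply: derivableM => //; exact: dg|exact: dg].
  rewrite RintegralB ?RintegralZl//; first ring; try exact: intK.
  exact: (integrableZl _ s (intK s n s0)).
have F_ge0 t : 0 <= F t by rewrite mulr_ge0 ?powR_ge0 ?expR_ge0.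
have Fle t : 0 < t -> F t <= (s + 1) `^ (s + 1) * t^-1.
  move=> t0; have h : t `^ s * t <= (s + 1) `^ (s + 1) * expR t.
    apply: le_trans (powR_le_expR s10 t0).
    by rewrite powRD ?gt_eqF ?implybT// powRr1// ltW.
  by rewrite ler_pdivlMr// /F mulrAC expRN ler_pdivrMr ?expR_gt0.
have Fle_powR t : 0 < t -> F t <= t `^ s.
  by move=> t0; rewrite /F ler_piMr ?powR_ge0// -expR0 ler_expR oppr_le0 ltW.
have cvgNV : (n.+2%:R^-1 : R) @[n --> \oo] --> (0 : R).
  have := @cvg_harmonic R; rewrite -(cvg_shiftn 1); apply: cvg_trans.
  by apply: near_eq_cvg; apply: nearW => n; rewrite /harmonic /= addn1.
have cvgF1 : F n.+2%:R @[n --> \oo] --> (0 : R).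
  apply: (@squeeze_cvgr _ _ _ _ (cst 0) (fun n => (s + 1) `^ (s + 1) * n.+2%:R^-1)).
  - by apply: nearW => n; rewrite F_ge0 Fle.
  - exact: cvg_cst.
  - by rewrite -[X in _ --> X](mulr0 ((s + 1) `^ (s + 1))); apply: cvgMr.
have cvgF2 : F n.+2%:R^-1 @[n --> \oo] --> (0 : R).
  apply: (@squeeze_cvgr _ _ _ _ (cst 0) (fun n => n.+2%:R^-1 `^ s)).
  - by apply: nearW => n; rewrite F_ge0 Fle_powR.
  - exact: cvg_cst.
  - have := powR_cvg0 s0; move/cvg_at_rightP; apply; split => [n|]; last exact: cvgNV.
    by rewrite invr_gt0.
rewrite -(cvg_lim _ (cvgK _ s10))//; apply/cvg_lim => //.
rewrite -[X in _ --> X]subr0 -[X in _ --> _ - X](subrr 0).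
under eq_cvg do rewrite -key.
apply: cvgB; last exact: cvgB.
by apply: cvgMr; exact: cvgK.
Qed.

Lemma is_derive_gamma_integrand (t x : R) : 0 < t ->
  is_derive x 1 (fun x => gamma_integrand x t) (ln t * gamma_integrand x t).
Proof.
move=> t0.
have dl : is_derive x 1 (fun x : R => (x - 1) * ln t) (ln t).
  have d1 : is_derive x 1 (fun x : R => x - 1) (1 - 0) by exact: is_deriveB.
  have h := is_deriveM d1 (is_derive_cst (ln t) x 1).
  by apply: (is_derive_eq h); rewrite /GRing.scale/=; ring.
have de := @is_derive1_comp _ expR (fun y : R => (y - 1) * ln t) _ _ _
  (is_derive_expR ((x - 1) * ln t)) dl.
have h := is_deriveM de (is_derive_cst (expR (- t)) x 1).
have -> : (fun x => gamma_integrand x t) =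
    ((expR \o (fun x => (x - 1) * ln t)) * cst (expR (- t)))%R.
  by apply/funext => y; rewrite /gamma_integrand /powR gt_eqF.
by apply: (is_derive_eq h); rewrite /gamma_integrand /powR gt_eqF// /GRing.scale/=; ring.
Qed.

Lemma ln_leB1 (u : R) : 0 < u -> ln u <= u - 1.
Proof.
move=> u0; have -> : ln u = ln (1 + (u - 1)) by rewrite addrC subrK.
by apply: le_ln1Dx; lra.
Qed.

(** An integrable bound of the derivative of the integrand in its parameter,
    uniform for x in the interval from 2e to s + 1.  The logarithm is absorbed by a
    power of t: ln t <= t for t >= 1, and - ln t <= t `^ (- e) / e for t < 1. *)
Lemma ln_gamma_integrand_le (e s x t : R) : 0 < e -> 0 < t -> 2 * e <= x <= s + 1 ->
  `|ln t * gamma_integrand x t| <=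
  gamma_integrand (s + 2) t + e^-1 * gamma_integrand e t.
Proof.
move=> e0 t0 /andP[ex xs].
rewrite normrM (ger0_norm (gamma_integrand_ge0 _ _)) /gamma_integrand !mulrA -mulrDl.
rewrite ler_pM2r ?expR_gt0//.
have pw (u : R) : 0 < t `^ u by rewrite powR_gt0.
have [t1|t1] := leP 1 t.
- apply: ler_wpDr; first by rewrite mulr_ge0 ?invr_ge0 ?(ltW (pw _)) ?ltW.
  rewrite ger0_norm ?ln_ge0//.
  have -> : t `^ (s + 2 - 1) = t * t `^ s.
    have -> : s + 2 - 1 = 1 + s by ring.
    by rewrite powRD ?(gt_eqF t0) ?implybT// powRr1// ltW.
  rewrite ler_pM ?ln_ge0 ?(ltW (pw _))//.
    by have := ln_leB1 t0; lra.
  by apply: ler_powR => //; lra.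
- apply: ler_wpDl; first exact: ltW.
  rewrite ler0_norm ?ln_le0 ?(ltW t1)//.
  have -> : t `^ (e - 1) = t `^ (- e) * t `^ (2 * e - 1).
    by rewrite -powRD ?(gt_eqF t0) ?implybT//; congr (powR _ _); ring.
  rewrite mulrA ler_pM ?oppr_ge0 ?ln_le0 ?(ltW t1) ?(ltW (pw _))//.
  + have := ln_leB1 (pw (- e)); rewrite ln_powR ler_pdivlMl//; lra.
  + by apply: ger_powR; rewrite ?t0 ?(ltW t1)//; lra.
Qed.

Lemma derivable_euler_Gamma s : 0 < s -> derivable (@euler_Gamma R) s 1.
Proof.
move=> s0.
(* Any e with 2e < s puts s inside the interval from 2e to s + 1. *)
pose e := s / 4.
pose G t := gamma_integrand (s + 2) t + e^-1 * gamma_integrand e t.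
have e0 : 0 < e by rewrite divr_gt0.
apply: (@derivable_under_integral _ _ _ mu gamma_integrand Rpos _ s (2 * e) (s + 1)
  _ _ _ G) => //.
- by rewrite /= in_itv/= /e; lra.
- move=> x /=; rewrite in_itv/= => /andP[xe _].
  by apply: integrable_gamma_integrand; lra.
- move=> x t _; rewrite /= in_itv/= andbT => t0.
  by case: (is_derive_gamma_integrand x t0).
- move=> t; apply: addr_ge0; first exact: gamma_integrand_ge0.
  by apply: mulr_ge0; [rewrite invr_ge0 ltW|exact: gamma_integrand_ge0].
- have s20 : 0 < s + 2 by lra.
  have mR : (R.-ocitv.-measurable).-sigma.-measurable Rpos by exact: measurable_itv.
  have i1 := integrable_gamma_integrand s20.
  have i2 := integrableZl mR e^-1 (integrable_gamma_integrand e0).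
  exact: (integrableD mR i1 i2).
- move=> x t; rewrite /= !in_itv/= andbT => /andP[ex xs] t0.
  rewrite partial1of2E; case: (is_derive_gamma_integrand x t0) => _ ->.
  by apply: ln_gamma_integrand_le; rewrite ?(ltW ex) ?(ltW xs).
Qed.

End GammaHalfLine.

(** * Pochhammer symbols and the continued Gamma function *)

Section Pochhammer.
Context {R : realType}.
Implicit Types (a b x : R) (m n i : nat).

Lemma pochhammer0 a : pochhammer a 0 = 1.
Proof. by rewrite /pochhammer big_ord0. Qed.

Lemma pochhammerSr a n : pochhammer a n.+1 = pochhammer a n * (a + n%:R).
Proof. by rewrite /pochhammer big_ord_recr. Qed.

Lemma pochhammerD a m n :
  pochhammer a (m + n) = pochhammer a m * pochhammer (a + m%:R) n.
Proof.
elim: n => [|n IH]; first by rewrite addn0 pochhammer0 mulr1.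
by rewrite addnS !pochhammerSr IH -mulrA natrD addrA.
Qed.

Lemma pochhammer_gt0 a n : 0 < a -> 0 < pochhammer a n.
Proof. by move=> a0; apply: prodr_gt0 => i _; rewrite ltr_pwDl. Qed.

Lemma pochhammer_neq0 a n : (forall m, a <> - m%:R) -> pochhammer a n != 0.
Proof.
move=> ha; apply/prodf_neq0 => i _; rewrite addr_eq0.
by apply/eqP => /ha.
Qed.

Lemma nat_shift_gt0 a : exists n : nat, 0 < a + n%:R.
Proof.
exists (Num.truncn (- a)).+1.
by have := truncnS_gt (- a); lra.
Qed.

(** Quantitative form of staying away from the poles: a single constant serves
    as the radius of a neighbourhood of a and as the slope of a lower bound for
    the factors of the Pochhammer symbols, whence |(b)_n| >= c ^+ n * n! there. *)
Lemma linear_bound_shift a : (forall m, a <> - m%:R) ->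
  exists2 c : R, 0 < c &
    forall b, `|b - a| <= c -> forall i, c * i.+1%:R <= `|b + i%:R|.
Proof.
move=> ha.
(* From the index N on, |a + i| >= (i + 1) / 2 holds by the triangle
   inequality; the sum in M takes care of the finitely many smaller indices. *)
pose N := (Num.truncn (2 * `|a| + 1)).+1.
pose M := 2 + \sum_(i < N) (i.+1%:R / `|a + i%:R|).
have ai i : 0 < `|a + i%:R|.
  by rewrite normr_gt0 addr_eq0; apply/eqP => /ha.
have Sge0 : 0 <= \sum_(i < N) (i.+1%:R / `|a + i%:R|).
  by apply: sumr_ge0 => i _; rewrite divr_ge0.
have M2 : 2 <= M by rewrite lerDl.
have Mle i : i.+1%:R <= M * `|a + i%:R|.
  have [iN|Ni] := ltnP i N.
    rewrite -ler_pdivrMr// /M (bigD1 (Ordinal iN))//= addrCA lerDl addr_ge0//.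
    by apply: sumr_ge0 => j _; rewrite divr_ge0.
  have h1 : 2 * `|a| + 1 < i%:R.
    by rewrite (lt_le_trans (truncnS_gt _))// ler_nat.
  have h2 : i%:R - `|a| <= `|a + i%:R|.
    have := lerB_normD i%:R a.
    by rewrite normr_nat addrC [a + _]addrC.
  have h3 := normr_ge0 a.
  rewrite -natr1; apply: (@le_trans _ _ (2 * `|a + i%:R|)); first lra.
  by rewrite ler_pM2r.
have M0 : 0 < M by lra.
exists (2 * M)^-1 => [|b hb i]; first by rewrite invr_gt0 mulr_gt0.
rewrite mulrC ler_pdivrMr ?mulr_gt0//.
rewrite -[_^-1]mul1r ler_pdivlMr ?mulr_gt0// in hb.
have h : `|a + i%:R| - `|b - a| <= `|b + i%:R|.
  have -> : a + i%:R = (b + i%:R) - (b - a) by ring.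
  by rewrite lerBlDr ler_normB.
have i1 : 1 <= i.+1%:R :> R by rewrite ler1n.
have := Mle i; nra.
Qed.

Lemma near_neq_oppr_nat a : (forall m, a <> - m%:R) ->
  \forall b \near a, forall m, b <> - m%:R.
Proof.
move=> /linear_bound_shift[c c0 hc].
exists c => //= b /ltW; rewrite distrC => bc m bm.
by have := hc b bc m; rewrite bm addNr normr0 leNgt mulr_gt0.
Qed.

End Pochhammer.

Section GammaContinuation.
Context {R : realType}.
Implicit Types (a b x : R) (m n : nat).

Lemma euler_GammaD x n : 0 < x ->
  euler_Gamma (x + n%:R) = pochhammer x n * euler_Gamma x.
Proof.
move=> x0; elim: n => [|n IH]; first by rewrite addr0 pochhammer0 mul1r.
rewrite -natr1 addrA euler_GammaS ?ltr_pwDl// IH pochhammerSr; ring.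
Qed.

(** Any shift into the positive half line computes Gamma, not just the least
    one.  With n independent of x, this makes the local behaviour of Gamma
    accessible.  It also holds at the poles, where both sides are 0. *)
Lemma GammaE x n : 0 < x + n%:R ->
  Gamma x = euler_Gamma (x + n%:R) / pochhammer x n.
Proof.
move=> xn; rewrite /Gamma; case: ifPn => [x0|].
  by rewrite euler_GammaD// mulrC mulKf// gt_eqF// pochhammer_gt0.
rewrite -leNgt => x0; set m := (Num.truncn (- x)).+1.
have xm : 0 < x + m%:R by have := truncnS_gt (- x); rewrite -/m; lra.
have mn : (m <= n)%N.
  have nx : 0 <= - x by rewrite oppr_ge0.
  by rewrite /m truncn_lt_nat//; lra.
rewrite -(subnKC mn) pochhammerD natrD addrA (euler_GammaD _ xm).
have := pochhammer_gt0 (n - m) xm; rewrite /= => p0.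
by rewrite invfM [X in _ = _ * X]mulrC mulrACA divff ?gt_eqF// mul1r.
Qed.

Lemma GammaS x : x != 0 -> Gamma (x + 1) = x * Gamma x.
Proof.
move=> x0; have [n xn] := nat_shift_gt0 x.
have xn1 : 0 < x + 1 + n%:R by lra.
have e : x + n.+1%:R = x + 1 + n%:R by rewrite -natr1; ring.
rewrite (GammaE xn1) (@GammaE x n.+1) e//.
rewrite -[in pochhammer x _]addn1 addnC pochhammerD pochhammerSr pochhammer0.
by rewrite mul1r addr0 invfM [RHS]mulrCA mulVKf.
Qed.

Lemma GammaD a n : (forall m, a <> - m%:R) ->
  Gamma (a + n%:R) = pochhammer a n * Gamma a.
Proof.
move=> ha; elim: n => [|n IH]; first by rewrite addr0 pochhammer0 mul1r.
rewrite -natr1 addrA GammaS ?IH ?pochhammerSr; first ring.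
by rewrite addr_eq0; apply/eqP => /ha.
Qed.

Lemma Gamma_neq0 a : (forall m, a <> - m%:R) -> Gamma a != 0.
Proof.
move=> ha; have [n an] := nat_shift_gt0 a.
by rewrite (GammaE an) mulf_neq0 ?invr_neq0 ?pochhammer_neq0// gt_eqF ?euler_Gamma_gt0.
Qed.

Lemma is_derive_shift x (c : R) : is_derive x (1 : R) (fun y : R => y + c) 1.
Proof.
have h := is_deriveD (is_derive_id x (1 : R)) (is_derive_cst c x (1 : R)).
by apply: (is_derive_eq h); rewrite addr0.
Qed.

Lemma derivable_shift (f : R -> R) x (c : R) : derivable f (x + c) 1 ->
  derivable (fun y => f (y + c)) x 1.
Proof.
move=> /derivableP df.
by have [] := @is_derive1_comp _ f (fun y : R => y + c) _ _ _ df (is_derive_shift x c).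
Qed.

Lemma derivable_pochhammer a n : derivable (fun x => pochhammer x n) a 1.
Proof.
elim: n => [|n IH].
  have -> : (fun x => pochhammer x 0) = cst (1 : R).
    by apply/funext => x; rewrite pochhammer0.
  exact: derivable_cst.
have -> : (fun x => pochhammer x n.+1) =
    (fun x => pochhammer x n) * (fun x => x + n%:R).
  by apply/funext => x; rewrite pochhammerSr.
by apply: derivableM => //; case: (is_derive_shift a n%:R).
Qed.

(** A shift n that works at a also works near a, where GammaE then expresses
    Gamma through functions known to be derivable. *)
Lemma derivable_Gamma a : (forall m, a <> - m%:R) -> derivable (@Gamma R) a 1.
Proof.
move=> ha; have [n an] := nat_shift_gt0 a.
have na : {near a, (fun b => euler_Gamma (b + n%:R) / pochhammer b n) =1 @Gamma R}.
  near=> b; rewrite (@GammaE b n)//.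
  near: b; exists (a + n%:R) => // b /=; rewrite ltr_distlC => /andP[h _]; lra.
apply: (near_eq_derivable na).
apply: derivableM.
  exact/derivable_shift/derivable_euler_Gamma.
by apply: derivableV; [exact: pochhammer_neq0|exact: derivable_pochhammer].
Unshelve. all: by end_near. Qed.

Lemma is_derive_Gamma a : (forall m, a <> - m%:R) ->
  is_derive a (1 : R) (@Gamma R) (digamma a * Gamma a).
Proof.
move=> ha; have /derivableP h := derivable_Gamma ha.
by apply: (is_derive_eq h); rewrite /digamma derive1E divfK ?Gamma_neq0.
Qed.

(** Logarithmic derivative of Gamma (a + 1) = a Gamma a. *)
Lemma digammaS a : (forall m, a <> - m%:R) -> digamma (a + 1) = digamma a + a^-1.
Proof.
move=> ha.
have a0 : a != 0 by apply/eqP; rewrite -oppr0; exact: (ha 0%N).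
have ha1 m : a + 1 <> - m%:R.
  by move=> h; apply: (ha m.+1); rewrite -natr1; lra.
have h1 := @is_derive1_comp _ (@Gamma R) (fun y : R => y + 1) _ _ _
  (is_derive_Gamma ha1) (is_derive_shift a 1).
have h2 := is_deriveM (is_derive_id a (1 : R)) (is_derive_Gamma ha).
have na : {near a, id * @Gamma R =1 @Gamma R \o (fun y : R => y + 1)}.
  near=> b; rewrite /= GammaS//.
  near: b; apply: filterS (near_neq_oppr_nat ha) => b hb.
  by apply/eqP; rewrite -oppr0; exact: (hb 0%N).
have h3 := near_eq_is_derive na h2.
have e : digamma (a + 1) * Gamma (a + 1) * 1 = a * (digamma a * Gamma a) + Gamma a.
  transitivity ('D_1 (@Gamma R \o (fun y : R => y + 1)) a).
    by case: h1 => _ ->.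
  by case: h3 => _ ->; rewrite /GRing.scale/=; ring.
have G0 := Gamma_neq0 ha.
rewrite mulr1 GammaS// in e.
apply: (mulIf (mulf_neq0 a0 G0)); rewrite e; field.
by rewrite a0.
Unshelve. all: by end_near. Qed.

Lemma digammaD a n : (forall m, a <> - m%:R) ->
  digamma (a + n%:R) = digamma a + \sum_(j < n) (a + j%:R)^-1.
Proof.
move=> ha; elim: n => [|n IH]; first by rewrite addr0 big_ord0 addr0.
rewrite -natr1 addrA digammaS ?IH ?big_ord_recr ?addrA// => m h.
by apply: (ha (n + m)%N); rewrite natrD; lra.
Qed.

End GammaContinuation.

(** * Term by term differentiation and regrouping of series *)

Section SeriesDerivative.
Context {R : realType}.
Implicit Types (u v M : R^nat) (n N : nat).

Lemma dominated_is_cvg_series v M : (forall n, `|v n| <= M n) ->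
  cvgn (series M) -> cvgn [normed series v].
Proof.
move=> vM; apply: series_le_cvg => n; first exact: normr_ge0.
  exact: le_trans (normr_ge0 _) (vM n).
exact: vM.
Qed.

Lemma dist_lim_series_le v M N : (forall n, `|v n| <= M n) ->
  cvgn (series M) ->
  `|limn (series v) - series v N| <= limn (series M) - series M N.
Proof.
move=> vM cM.
have cv : cvgn (series v) by exact/normed_cvg/(dominated_is_cvg_series vM).
have cv' : `|series v n - series v N| @[n --> \oo] --> `|limn (series v) - series v N|.
  by apply: cvg_norm; apply: cvgB; [exact: cv|exact: cvg_cst].
have cM' : series M n - series M N @[n --> \oo] --> limn (series M) - series M N.
  by apply: cvgB; [exact: cM|exact: cvg_cst].
apply: (ler_cvg_to cv' cM'); exists N => // n /= Nn.
rewrite !sub_series_geq//; apply: (le_trans (ler_norm_sum _ _ _)).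
by apply: ler_sum => i _; exact: vM.
Qed.

Lemma dist_le_derive_bound (f df : R -> R) (K a b r : R) :
  (forall x, `|x - a| <= r -> is_derive x (1 : R) f (df x)) ->
  (forall x, `|x - a| <= r -> `|df x| <= K) ->
  `|b - a| <= r -> `|f b - f a| <= K * `|b - a|.
Proof.
move=> dff dfK br.
have main x y : x <= y -> (forall z, z \in `[x, y] -> `|z - a| <= r) ->
    `|f y - f x| <= K * `|y - x|.
  move=> xy h.
  have [|c cxy ->] := @MVT_segment _ f df x y xy (fun z hz => dff z (h z (subset_itv_oo_cc hz))).
    apply: derivable_within_continuous => z hz.
    by case: (dff z (h z hz)).
  by rewrite normrM ler_wpM2r// dfK// h.
have [ab|ba] := leP a b.
  apply: main => // z; rewrite in_itv/= => /andP[az zb].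
  apply: le_trans br; rewrite !ger0_norm ?subr_ge0//; lra.
rewrite distrC [`|b - a|]distrC; apply: main; first exact: ltW.
move=> z; rewrite in_itv/= => /andP[bz za].
apply: le_trans br; rewrite !ler0_norm ?subr_le0//; lra.
Qed.

(** By the mean value inequality, M also dominates the difference quotients of
    the terms.  The tails of the series of difference quotients are thus
    uniformly small, and only a finite sum of them has to be passed to the limit. *)
Lemma is_derive_series (u du : nat -> R -> R) M (a r : R) : 0 < r ->
  (forall n x, `|x - a| <= r -> is_derive x (1 : R) (u n) (du n x)) ->
  (forall n x, `|x - a| <= r -> `|du n x| <= M n) ->
  cvgn (series M) ->
  (forall x, `|x - a| <= r -> cvgn (series (u ^~ x))) ->
  is_derive a (1 : R) (fun x => limn (series (u ^~ x))) (limn (series (du ^~ a))).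
Proof.
move=> r0 dudx duM cM cu.
have aa : `|a - a| <= r by rewrite subrr normr0 ltW.
pose F x := limn (series (u ^~ x)).
pose w h n := h^-1 * (u n (h + a) - u n a).
suff H : h^-1 *: (F (h + a) - F a) @[h --> 0^'] --> limn (series (du ^~ a)).
  apply: DeriveDef.
    apply/cvg_ex; exists (limn (series (du ^~ a))).
    by under eq_fun do rewrite scaler1.
  by rewrite -derive1E; apply/cvg_lim.
have wM h : `|h| <= r -> forall n, `|w h n| <= M n.
  move=> hr n; rewrite /w normrM normfV.
  have [->|h0] := eqVneq h 0.
    rewrite normr0 invr0 mul0r; exact: le_trans (normr_ge0 _) (duM n a aa).
  rewrite ler_pdivrMl ?normr_gt0// mulrC.
  have := @dist_le_derive_bound (u n) (du n) (M n) a (h + a) r (dudx n) (duM n).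
  by rewrite addrK; apply.
have wlim h : `|h| <= r -> limn (series (w h)) = h^-1 *: (F (h + a) - F a).
  move=> hr.
  have har : `|h + a - a| <= r by rewrite addrK.
  rewrite -lim_seriesB; [|exact: cu|exact: cu].
  by rewrite -lim_seriesZ//; apply: is_cvg_seriesB; exact: cu.
have wN N : series (w h) N @[h --> 0^'] --> series (du ^~ a) N.
  rewrite /series/= big_mkord; under eq_cvg do rewrite big_mkord.
  apply: cvg_big => [|n _]; first exact: add_continuous.
  have [dn <-] := dudx n a aa.
  move: (dn); rewrite /derivable /derive /w.
  by under eq_fun do rewrite scaler1.
apply/cvgrPdist_le => e e0.
have e30 : 0 < e / 3 by lra.
have [N hN] : exists N, limn (series M) - series M N <= e / 3.
  move/cvgrPdist_le : cM => /(_ _ e30)[N _ /(_ N (leqnn N))] /= h.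
  by exists N; apply: le_trans h; exact: ler_norm.
have /cvgrPdist_le /(_ _ e30) wNe := wN N.
near=> h.
have hr : `|h| <= r.
  near: h; apply: nbhs_dnbhs; exists r => // h /=.
  by rewrite sub0r normrN => /ltW.
rewrite -wlim//.
have h1 := dist_lim_series_le N (wM h hr) cM.
have h2 := dist_lim_series_le N (fun n => duM n a aa) cM.
have h3 : `|series (du ^~ a) N - series (w h) N| <= e / 3 by near: h.
rewrite distrC in h1.
have -> : limn (series (du ^~ a)) - limn (series (w h)) =
  (limn (series (du ^~ a)) - series (du ^~ a) N) +
  (series (du ^~ a) N - series (w h) N) + (series (w h) N - limn (series (w h))).
  by ring.
apply: (le_trans (ler_normD _ _)).
apply: (le_trans (lerD (ler_normD _ _) (lexx _))).
lra.
Unshelve. all: by end_near. Qed.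

(** Absolute convergence of the q subseries bounds the partial sums of the
    absolute values of t, so the whole series converges; its sum can then be read
    off the partial sums of length n * q. *)
Lemma cvg_series_group (t : R^nat) (q : nat) (l : 'I_q -> R) : (0 < q)%N ->
  (forall h : 'I_q, cvgn [normed series (fun n => t (n * q + h)%N)]) ->
  (forall h : 'I_q, series (fun n => t (n * q + h)%N) @ \oo --> l h) ->
  limn (series t) = \sum_(h < q) l h.
Proof.
move=> q0 ct tl.
have group (f : R^nat) n :
    series f (n * q)%N = \sum_(h < q) series (fun n => f (n * q + h)%N) n.
  elim: n => [|n IH].
    by rewrite mul0n /series/= big_geq// big1// => i _; rewrite big_geq.
  rewrite mulSnr /series/= (@big_cat_nat _ _ _ (n * q))//= ?leq_addr//.
  rewrite [X in X + _]IH -{1}[(n * q)%N]add0n big_addn addKn big_mkord -big_split/=.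
  by apply: eq_bigr => h _; rewrite /series/= big_nat_recr//= addnC.
have cnt : cvgn [normed series t].
  apply: nondecreasing_is_cvgn.
    by apply: nondecreasing_series => n _ _; exact: normr_ge0.
  exists (\sum_(h < q) limn [normed series (fun n => t (n * q + h)%N)]).
  move=> _ [N _ <-]; apply: (@le_trans _ _ ([normed series t] (N * q)%N)).
    apply: nondecreasing_series => [n _ _|]; first exact: normr_ge0.
    exact: leq_pmulr.
  rewrite [leLHS](group (fun n => `|t n|) N); apply: ler_sum => h _.
  apply: nondecreasing_cvgn_le (ct h) N.
  by apply: nondecreasing_series => n _ _; exact: normr_ge0.
have /normed_cvg cst := cnt.
have sub : series t (n * q)%N @[n --> \oo] --> limn (series t).
  by apply: cvg_comp cst; exact: cvg_mulnr.
rewrite -(cvg_lim _ sub)//; apply/cvg_lim => //.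
under eq_cvg do rewrite group.
by apply: cvg_big => [|h _]; [exact: add_continuous|exact: tl].
Qed.

End SeriesDerivative.

(** * The confluent series and the Mittag-Leffler function *)

Section Confluent.
Context {R : realType}.
Implicit Types (a b y : R) (n : nat).

Definition confluent_term y a n : R := y ^+ n / pochhammer a n.

(** The derivative of [confluent_term y a n] with respect to a. *)
Definition confluent_dterm y a n : R :=
  - (y ^+ n / pochhammer a n * \sum_(j < n) (a + j%:R)^-1).

(** The confluent hypergeometric function 1F1 (1; a; y): the factorials cancel
    because (1)_n = n!. *)
Definition confluent a y : R := limn (series (confluent_term y a)).

Lemma is_derive_pochhammerV a n : (forall m : nat, a <> - m%:R) ->
  is_derive a (1 : R) (fun b => (pochhammer b n)^-1)
    (- ((pochhammer a n)^-1 * \sum_(j < n) (a + j%:R)^-1)).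
Proof.
move=> ha; elim: n => [|n IH].
  have -> : (fun b => (pochhammer b 0)^-1) = cst (1 : R).
    by apply/funext => x; rewrite pochhammer0 invr1.
  apply: (is_derive_eq (is_derive_cst (1 : R) a (1 : R))).
  by rewrite big_ord0 mulr0 oppr0.
have an : a + n%:R != 0 by rewrite addr_eq0; apply/eqP => /ha.
have -> : (fun b => (pochhammer b n.+1)^-1) =
    (fun b => (pochhammer b n)^-1) * (fun b => (b + n%:R)^-1).
  by apply/funext => x; rewrite pochhammerSr invfM.
have h := is_deriveM IH (@is_deriveV _ (fun b : R => b + n%:R) _ _ _ an (is_derive_shift a n%:R)).
apply: (is_derive_eq h); rewrite pochhammerSr big_ord_recr/= /GRing.scale/=.
have p0 := pochhammer_neq0 n ha.
by field; rewrite an p0.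
Qed.

Lemma is_derive_confluent_term a y n : (forall m : nat, a <> - m%:R) ->
  is_derive a (1 : R) (fun b => confluent_term y b n) (confluent_dterm y a n).
Proof.
move=> ha; have h := is_deriveZ (y ^+ n) (is_derive_pochhammerV n ha).
by apply: (is_derive_eq h); rewrite /confluent_dterm /GRing.scale/= mulrN mulrA.
Qed.

Lemma confluent_term_le (c a y : R) n : 0 < c ->
  (forall i : nat, c * i.+1%:R <= `|a + i%:R|) ->
  `|confluent_term y a n| <= exp_coeff (`|y| / c) n.
Proof.
move=> c0 hc; rewrite /confluent_term /exp_coeff/= normrM normrX normfV expr_div_n -mulrA.
rewrite ler_wpM2l ?exprn_ge0// -invfM.
have H : c ^+ n * n`!%:R <= `|pochhammer a n|.
  elim: n => [|n IH]; first by rewrite expr0 fact0 mul1r pochhammer0 normr1.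
  rewrite exprSr factS mulnC natrM mulrACA pochhammerSr normrM.
  by rewrite ler_pM// mulr_ge0// ?exprn_ge0// ltW.
have c1 : 0 < c ^+ n * n`!%:R by rewrite mulr_gt0 ?exprn_gt0// ltr0n fact_gt0.
by rewrite lef_pV2// posrE// (lt_le_trans c1).
Qed.

(** The sum of the n reciprocals is at most n / c, and n <= 2 ^+ n keeps the
    bound within an exponential series. *)
Lemma confluent_dterm_le (c a y : R) n : 0 < c ->
  (forall i : nat, c * i.+1%:R <= `|a + i%:R|) ->
  `|confluent_dterm y a n| <= c^-1 * exp_coeff (2 * `|y| / c) n.
Proof.
move=> c0 hc.
have -> : exp_coeff (2 * `|y| / c) n = 2 ^+ n * exp_coeff (`|y| / c) n.
  by rewrite /exp_coeff/= -mulrA exprMn mulrA.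
have h2 : `|\sum_(j < n) (a + j%:R)^-1| <= 2 ^+ n * c^-1.
  apply: (@le_trans _ _ (n%:R * c^-1)).
    apply: (le_trans (ler_norm_sum _ _ _)).
    apply: (@le_trans _ _ (\sum_(j < n) c^-1)); last first.
      by rewrite sumr_const card_ord mulr_natl.
    apply: ler_sum => j _; rewrite normfV.
    have h : c <= `|a + j%:R| by rewrite (le_trans _ (hc j))// ler_peMr ?ler1n ?(ltW c0).
    by rewrite lef_pV2// posrE (lt_le_trans c0).
  by rewrite ler_wpM2r ?invr_ge0 ?(ltW c0)// -natrX ler_nat ltnW// ltn_expl.
rewrite normrN normrM mulrA [leRHS]mulrC [c^-1 * _]mulrC.
by rewrite ler_pM// confluent_term_le.
Qed.

Lemma normed_cvg_confluent a y : (forall m : nat, a <> - m%:R) ->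
  cvgn [normed series (confluent_term y a)].
Proof.
move=> /linear_bound_shift[c c0 hc].
have hca : forall i : nat, c * i.+1%:R <= `|a + i%:R|.
  by apply: hc; rewrite subrr normr0 ltW.
apply: dominated_is_cvg_series (is_cvg_series_exp_coeff (`|y| / c)).
by move=> n; apply: confluent_term_le c0 hca.
Qed.

Lemma cvg_confluent_dterm a y : (forall m : nat, a <> - m%:R) ->
  cvgn (series (confluent_dterm y a)).
Proof.
move=> /linear_bound_shift[c c0 hc].
have hca : forall i : nat, c * i.+1%:R <= `|a + i%:R|.
  by apply: hc; rewrite subrr normr0 ltW.
have cM := @is_cvg_seriesZ _ _ c^-1 (is_cvg_series_exp_coeff (2 * `|y| / c)).
apply/normed_cvg/(dominated_is_cvg_series _ cM).
by move=> n; apply: confluent_dterm_le c0 hca.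
Qed.

Lemma is_derive_confluent a y : (forall m : nat, a <> - m%:R) ->
  is_derive a (1 : R) (fun b => confluent b y) (limn (series (confluent_dterm y a))).
Proof.
move=> /linear_bound_shift[c c0 hc].
have np b : `|b - a| <= c -> forall m : nat, b <> - m%:R.
  move=> bc m bm; have := hc b bc m.
  by rewrite bm addNr normr0 leNgt mulr_gt0.
have cM := @is_cvg_seriesZ _ _ c^-1 (is_cvg_series_exp_coeff (2 * `|y| / c)).
apply: (@is_derive_series _ (fun n b => confluent_term y b n)
  (fun n b => confluent_dterm y b n) _ a c c0 _ _ cM).
- by move=> n x xc; exact/is_derive_confluent_term/np.
- by move=> n x xc; apply: confluent_dterm_le => //; exact: hc.
- by move=> x xc; exact/normed_cvg/normed_cvg_confluent/np.
Qed.

(** Both sides are the sum of y ^+ n / (a)_n * digamma (a + n) over n >= 0: on the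
    right by the recurrence for digamma, on the left because Qfun leaves out
    exactly the term n = 0. *)
Lemma digammaD_Qfun a y : (forall m : nat, a <> - m%:R) ->
  digamma a + Qfun a y =
  digamma a * confluent a y - limn (series (confluent_dterm y a)).
Proof.
move=> ha.
have cc := normed_cvg (@normed_cvg_confluent a y ha).
have cc' := @cvg_confluent_dterm a y ha.
have cd := @is_cvg_seriesZ _ _ (digamma a) cc.
rewrite -[_ * confluent a y](lim_seriesZ _ cc) -lim_seriesB//.
pose v n := y ^+ n / pochhammer a n * digamma (n%:R + a).
have vE : digamma a *: confluent_term y a - confluent_dterm y a = v.
  apply/funext => n.
  rewrite /v /confluent_term /confluent_dterm [n%:R + a]addrC digammaD//.
  rewrite !fctE /GRing.scale/=; ring.
have cv : cvgn (series v).
  by rewrite -vE; apply: is_cvg_seriesB.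
have v0 : v 0%N = digamma a by rewrite /v pochhammer0 expr0 divr1 mul1r add0r.
rewrite vE -v0 addrC; apply/eqP; rewrite eq_sym -subr_eq eq_sym; apply/eqP.
apply/cvg_lim => //.
have cvS : series v (n + 1)%N @[n --> \oo] --> limn (series v).
  by rewrite (cvg_shiftn 1 (series v)); exact: cv.
apply: cvg_trans (cvgB cvS (cvg_cst (v 0%N))); apply: near_eq_cvg; apply: nearW => n.
by rewrite !fctE /series/= addn1 big_nat_recl//= addrC addKr.
Qed.

Lemma is_derive_confluent_div_Gamma a y : (forall m : nat, a <> - m%:R) ->
  is_derive a (1 : R) (fun b => confluent b y / Gamma b)
    (- ((Gamma a)^-1 * (digamma a + Qfun a y))).
Proof.
move=> ha; have G0 := Gamma_neq0 ha.
have h := is_deriveM (is_derive_confluent y ha) (is_deriveV G0 (is_derive_Gamma ha)).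
apply: (is_derive_eq h); rewrite digammaD_Qfun// /GRing.scale/=.
by field.
Qed.

End Confluent.

Section MittagLeffler.
Context {R : realType}.

(** Regrouping by residue modulo q, with k / q + b = (h / q + b) + n for
    k = n * q + h. *)
Lemma mittag_leffler_confluent (q : nat) (x b : R) : (0 < q)%N ->
  (forall h m : nat, (h < q)%N -> h%:R / q%:R + b <> - m%:R) ->
  mittag_leffler q%:R^-1 b x =
  \sum_(h < q) x ^+ h * (confluent (h%:R / q%:R + b) (x ^+ q) / Gamma (h%:R / q%:R + b)).
Proof.
move=> q0 hb; pose t k := x ^+ k / Gamma (q%:R^-1 * k%:R + b).
have q0R : q%:R != 0 :> R by rewrite pnatr_eq0 -lt0n.
have tE (h : 'I_q) : (fun n => t (n * q + h)%N) =
    (x ^+ h / Gamma (h%:R / q%:R + b)) *: confluent_term (x ^+ q) (h%:R / q%:R + b).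
  apply/funext => n; rewrite /t.
  have -> : q%:R^-1 * (n * q + h)%:R + b = (h%:R / q%:R + b) + n%:R.
    by rewrite natrD natrM; field.
  rewrite (GammaD n (fun m => hb h m (ltn_ord h))) /confluent_term !fctE /GRing.scale/=.
  by rewrite exprD mulnC exprM invfM; ring.
rewrite /mittag_leffler -/t; apply: cvg_series_group => // h; rewrite tE.
- have cn := @normed_cvg_confluent _ _ (x ^+ q) (fun m => hb h m (ltn_ord h)).
  set k := x ^+ h / _.
  apply: dominated_is_cvg_series (@is_cvg_seriesZ _ _ `|k| cn) => n.
  by rewrite !fctE /GRing.scale/= normrM.
- have cc := normed_cvg (@normed_cvg_confluent _ _ (x ^+ q) (fun m => hb h m (ltn_ord h))).
  set k := x ^+ h / _.
  have -> : x ^+ h * (confluent (h%:R / q%:R + b) (x ^+ q) / Gamma (h%:R / q%:R + b)) =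
      limn (series (k *: confluent_term (x ^+ q) (h%:R / q%:R + b))).
    by rewrite lim_seriesZ// /k /GRing.scale/= mulrA mulrAC.
  exact: is_cvg_seriesZ.
Qed.

End MittagLeffler.

Unset Implicit Arguments.

Theorem theorem5p1 (R : realType) (q : nat) (x beta : R)
    (hq : (1 <= q)%N)
    (hbeta : forall h m : nat, (h < q)%N -> h%:R / q%:R + beta <> - m%:R) :
  is_derive beta (1 : R) (fun b : R => mittag_leffler (q%:R^-1) b x)
    (- \sum_(h < q) x ^+ h / Gamma (h%:R / q%:R + beta) *
         (digamma (h%:R / q%:R + beta) + Qfun (h%:R / q%:R + beta) (x ^+ q))).
Proof.
pose f (h : 'I_q) (b : R) := x ^+ h *
  (confluent (h%:R / q%:R + b) (x ^+ q) / Gamma (h%:R / q%:R + b)).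
(* The regrouping needs all the h / q + b to avoid the poles, which persists
   for b near beta. *)
have near_E : {near beta, \sum_(h < q) f h =1 (fun b => mittag_leffler q%:R^-1 b x)}.
  have : \forall b \near beta, forall h : 'I_q, forall m : nat, h%:R / q%:R + b <> - m%:R.
    apply: (@filter_forall R 'I_q (fun h b => forall m : nat,
      h%:R / q%:R + b <> - m%:R) (nbhs beta)) => h.
    have hc : h%:R / q%:R + b @[b --> beta] --> h%:R / q%:R + beta.
      by apply: cvgD; [exact: cvg_cst|exact: cvg_id].
    exact: (hc _ (near_neq_oppr_nat (fun m => hbeta h m (ltn_ord h)))).
  apply: filterS => b hb; rewrite mittag_leffler_confluent//; last first.
    by move=> h m hq'; exact: (hb (Ordinal hq')).
  by rewrite fct_sumE.
have df (h : 'I_q) : is_derive beta (1 : R) (f h)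
    (- (x ^+ h / Gamma (h%:R / q%:R + beta) *
         (digamma (h%:R / q%:R + beta) + Qfun (h%:R / q%:R + beta) (x ^+ q)))).
  have dl : is_derive beta (1 : R) (fun b : R => h%:R / q%:R + b) 1.
    have d := is_deriveD (is_derive_cst (h%:R / q%:R : R) beta (1 : R)) (is_derive_id beta (1 : R)).
    by apply: (is_derive_eq d); rewrite add0r.
  have dc := @is_derive1_comp _ (fun a => confluent a (x ^+ q) / Gamma a) _ _ _ _
    (is_derive_confluent_div_Gamma (x ^+ q) (fun m => hbeta h m (ltn_ord h))) dl.
  apply: (is_derive_eq (is_deriveZ (x ^+ h) dc)).
  by rewrite /GRing.scale/= mulr1 mulrN mulrA.
have := near_eq_is_derive near_E (is_derive_sum df).
by move=> H; apply: (is_derive_eq H); rewrite sumrN.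
Qed.
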